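(* The smallest number of qubits $n$ for which there exists an $n$-qubit permutation gate in $\mathcal{C}_3$ that is not semi-Clifford is $7$.
   Context: Gates on $n$ qubits are unitary operators on $(\mathbb{C}^2)^{\otimes n}$, with computational basis $\{|v\rangle : v\in\mathbb{F}_2^n\}$. The Pauli group $\mathcal{P}_n$ consists of all $cP_1\otimes\cdots\otimes P_n$ with $c\in\{\pm1,\pm i\}$ and $P_j\in\{I_2,X,Y,Z\}$. The Clifford hierarchy: $\mathcal{C}_1=\mathcal{P}_n$, and for $k\ge2$, $\mathcal{C}_k$ is the set of unitaries $U$ with $UPU^\dagger\in\mathcal{C}_{k-1}$ for all $P\in\mathcal{P}_n$. $\mathcal{C}_2$ is the Clifford group. A permutation gate is a unitary whose matrix in the computational basis is a permutation matrix. A gate is semi-Clifford if it equals $\phi_1d\phi_2$ for some Clifford gates $\phi_1,\phi_2$ and some gate $d$ that is diagonal in the computational basis. *)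

(* Defs.v *)
From mathcomp Require Import all_boot all_order all_fingroup all_algebra.
From mathcomp Require Export sesquilinear spectral.
From mathcomp Require Export complex reals.

Set Implicit Arguments.
Unset Strict Implicit.
Unset Printing Implicit Defensive.

Import GRing.Theory Num.Theory.
Local Open Scope ring_scope.
Local Open Scope sesquilinear_scope.

Section Gates.
Variable C : numClosedFieldType.

(* Operators on (C^2)^{(x) n}, as matrices in the computational basis
   {|v> : v in F_2^n}: the row (or column) index a : 'I_#|{: 'rV['F_2]_n}|
   stands for the basis vector |bits a>. *)
Definition operator (n : nat) : Type := 'M[C]_#|{: 'rV['F_2]_n}|.

Definition bits n (a : 'I_#|{: 'rV['F_2]_n}|) : 'rV['F_2]_n := enum_val a.

Definition mx22 (a b c d : C) : 'M[C]_2 :=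
  \matrix_(i, j) if i == 0 then (if j == 0 then a else b)
                 else (if j == 0 then c else d).

Definition pauliX : 'M[C]_2 := mx22 0 1 1 0.
Definition pauliY : 'M[C]_2 := mx22 0 (- 'i) 'i 0.
Definition pauliZ : 'M[C]_2 := mx22 1 0 0 (- 1).

(* P_1 (x) ... (x) P_n, given by <u| P_1 (x) ... (x) P_n |v> =
   \prod_j <u_j| P_j |v_j>; elements of 'F_2 serve as indices because
   'F_2 is convertible to 'I_2. *)
Definition tensor n (P : 'I_n -> 'M[C]_2) : operator n :=
  \matrix_(a, b) \prod_(j < n) P j (bits a 0 j) (bits b 0 j).

Definition pauli_group n (U : operator n) : Prop :=
  exists c : C, exists P : 'I_n -> 'M[C]_2,
    [/\ c \in [:: 1; - 1; 'i; - 'i],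
        forall j, P j \in [:: 1%:M; pauliX; pauliY; pauliZ]
      & U = c *: tensor P].

(* The level C_k of the Clifford hierarchy.  Levels start at k = 1; the value
   at k = 0 is a placeholder. *)
Fixpoint clifford_hierarchy n (k : nat) (U : operator n) : Prop :=
  match k with
  | 0 => False
  | 1 => pauli_group U
  | k'.+1 =>
      U \is unitarymx /\
      forall P : operator n, pauli_group P ->
        clifford_hierarchy k' (U *m P *m U^t*)
  end.

Definition clifford_gate n (U : operator n) : Prop := clifford_hierarchy 2 U.

Definition permutation_gate n (U : operator n) : Prop :=
  U \is unitarymx /\ is_perm_mx U.

Definition diagonal_gate n (U : operator n) : Prop :=
  U \is unitarymx /\ is_diag_mx U.

Definition semi_clifford n (U : operator n) : Prop :=
  exists phi1 d phi2 : operator n,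
    [/\ clifford_gate phi1, diagonal_gate d, clifford_gate phi2
      & U = phi1 *m d *m phi2].

End Gates.

(* Main.v *)
(** Let U be a permutation gate in the third level, given by a bijection f of
    V = F_2^n.  Conjugating the X^a shows that every map f^-1(f(.) + a) is affine,
    so the group law transported from V by f - f(0) is u o v = u + v + uv for a
    commutative associative bilinear product with u^2 = 0.  If abc <> 0, then
    a, b, c, ab, ac, bc, abc are linearly independent.  Hence for n <= 6 all
    triple products vanish, f(u + v) = f(u) + f(v) + f(uv), and up to affine
    changes of coordinates f is a shear w |-> w + q(w) along the annihilator of
    the product, which Hadamard gates on the coordinates of that subspace make
    diagonal.

    For n = 7 the augmentation ideal of F_2[a, b, c] / (a^2, b^2, c^2) yields a
    quadratic f, so the gate lies in the third level.  A semi-Clifford gate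
    conjugates 2^7 Paulis, distinct up to phase, to Paulis; this one does so for
    at most 2^4. *)

Require Import Defs.
From mathcomp Require Import all_boot all_order all_fingroup all_algebra.
From mathcomp Require Import complex reals ring.

Set Implicit Arguments.
Unset Strict Implicit.
Unset Printing Implicit Defensive.

Import Order.TTheory GRing.Theory Num.Theory.
Local Open Scope ring_scope.
Local Open Scope sesquilinear_scope.

(** * Vectors over F_2 *)

Lemma F2_evens : [/\ (2 : 'F_2) = 0, (4 : 'F_2) = 0, (6 : 'F_2) = 0 & (8 : 'F_2) = 0].
Proof. by split; apply: val_inj. Qed.

Lemma addF2_eq0 (x y : 'F_2) : x + y = 0 -> x = y.
Proof. by move/eqP; rewrite addr_eq0 oppr_pchar2 ?pchar_Fp // => /eqP. Qed.

(* [ring] over 'F_2: all coefficients of the sum of both sides are even, and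
   [ring] reduces only by hypotheses whose coefficient it meets exactly. *)
Ltac F2_ring := let e2 := fresh in let e4 := fresh in let e6 := fresh in
  let e8 := fresh in
  apply: addF2_eq0; case: F2_evens => e2 e4 e6 e8; ring: e2 e4 e6 e8.

(** Matrix products become atoms first, because [mxE] would unfold them into sums that [F2_ring]
    cannot match. *)
Ltac addv_solve :=
  repeat match goal with |- context [@mulmx ?R ?m ?n ?p ?A ?B] =>
    generalize (@mulmx R m n p A B); intro end;
  apply/rowP => ?; rewrite ?mxE; F2_ring.

Section BinaryVectors.
Variable n : nat.
Local Notation V := 'rV['F_2]_n.
Implicit Types u v w : V.

Lemma addFF (x : 'F_2) : x + x = 0.
Proof. exact/addrr_pchar2/pchar_Fp. Qed.

Lemma add2v v : v + v = 0.
Proof. by apply/rowP=> i; rewrite !mxE addFF. Qed.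

Lemma addKv u v : u + (u + v) = v.
Proof. by rewrite addrA add2v add0r. Qed.

Lemma addvK u v : v + u + u = v.
Proof. by rewrite -addrA add2v addr0. Qed.

Lemma addv_eq0 u v : u + v = 0 -> u = v.
Proof. by move=> uv0; rewrite -[LHS](addvK v) uv0 add0r. Qed.

Lemma eq_addv0 u v : u = v -> u + v = 0.
Proof. by move->; rewrite add2v. Qed.

Lemma F2_cases (x : 'F_2) : x = 0 \/ x = 1.
Proof. by case: x => [[|[|//]] lt]; [left | right]; apply: val_inj. Qed.

Definition dot u v : 'F_2 := (u *m v^T) 0 0.

Lemma dotE u v : dot u v = \sum_i u 0 i * v 0 i.
Proof. by rewrite /dot mxE; apply: eq_bigr => i _; rewrite mxE. Qed.

Lemma dotC u v : dot u v = dot v u.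
Proof. by rewrite !dotE; apply: eq_bigr => i _; rewrite mulrC. Qed.

Lemma dotDl u v w : dot (u + v) w = dot u w + dot v w.
Proof. by rewrite /dot mulmxDl mxE. Qed.

Lemma dotDr u v w : dot w (u + v) = dot w u + dot w v.
Proof. by rewrite !(dotC w) dotDl. Qed.

Lemma dot0l v : dot 0 v = 0.
Proof. by rewrite /dot mul0mx mxE. Qed.

Lemma dot0r v : dot v 0 = 0.
Proof. by rewrite dotC dot0l. Qed.

Lemma dot_delta v i : dot (delta_mx 0 i) v = v 0 i.
Proof. by rewrite /dot -rowE !mxE. Qed.

Lemma dot_mulmxl (A : 'M['F_2]_n) u v : dot (u *m A) v = dot u (v *m A^T).
Proof. by rewrite /dot trmx_mul trmxK mulmxA. Qed.

Lemma additive_scaleF2 (h : V -> 'F_2) : {morph h : u v / u + v} ->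
  forall (x : 'F_2) v, h (x *: v) = x * h v.
Proof.
move=> hD x v; have h0 : h 0 = 0.
  by have := addFF (h 0); rewrite -hD addr0.
by case: (F2_cases x) => ->; rewrite ?scale0r ?mul0r ?scale1r ?mul1r.
Qed.

Lemma additive_dot (h : V -> 'F_2) : {morph h : u v / u + v} ->
  exists b, forall u, h u = dot u b.
Proof.
move=> hD; exists (\row_i h (delta_mx 0 i)) => u.
rewrite dotE {1}[u]row_sum_delta.
have h0 : h 0 = 0 by rewrite -[0](scale0r 0) additive_scaleF2 // mul0r.
rewrite (big_morph h hD h0); apply: eq_bigr => i _.
by rewrite additive_scaleF2 // !mxE.
Qed.

End BinaryVectors.

(** * Monomial operators, Pauli and Clifford gates *)

Section Operators.
Variable C : numClosedFieldType.

Definition chi (x : 'F_2) : C := (-1) ^+ x.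

Lemma chiD : {morph chi : x y / x + y >-> x * y}.
Proof.
move=> x y; case: (F2_cases x) => ->; case: (F2_cases y) => ->;
by rewrite /chi ?addFF ?addr0 ?add0r ?expr0 ?expr1 ?mulr1 ?mul1r ?mulrNN ?mulr1.
Qed.

Lemma chi0 : chi 0 = 1. Proof. by []. Qed.

Lemma chi1 : chi 1 = -1. Proof. exact: expr1. Qed.

Lemma chi_sqr x : chi x * chi x = 1.
Proof. by rewrite -chiD addFF. Qed.

Lemma chi_phase x : chi x ^+ 4 = 1.
Proof. by rewrite (exprM _ 2 2) (chi_sqr x : chi x ^+ 2 = 1) expr1n. Qed.

Lemma chi_neq0 x : chi x != 0.
Proof. by rewrite /chi signr_eq0. Qed.

Lemma chi_conj x : (chi x)^* = chi x.
Proof. by rewrite /chi rmorphXn /= rmorphN rmorph1. Qed.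

Lemma chi_inj : injective chi.
Proof.
have /eqP ne : (1 : C) != -1 by rewrite -subr_eq0 opprK (pnatr_eq0 C 2).
move=> x y; case: (F2_cases x) => ->; case: (F2_cases y) => -> //;
  rewrite /chi /= ?expr0 ?expr1 => E.
by case: ne.
Qed.

(** The four Pauli phases are the roots of X^4 - 1, and that equation passes directly to products
    and inverses. *)
Lemma phaseP (c : C) : reflect (c ^+ 4 = 1) (c \in [:: 1; - 1; 'i; - 'i]).
Proof.
have E : (c - 1) * ((c + 1) * ((c - 'i) * (c + 'i))) = c ^+ 4 - 1.
  transitivity ((c ^+ 2 - 1) * (c ^+ 2 - 'i ^+ 2)); first by ring.
  by rewrite sqrCi; ring.
suff -> : (c \in [:: 1; - 1; 'i; - 'i]) = (c ^+ 4 == 1) by apply: eqP.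
by rewrite !inE -[c ^+ 4 == 1]subr_eq0 -E !mulf_eq0 !subr_eq0 !addr_eq0.
Qed.

Lemma phase_conj (c : C) : c ^+ 4 = 1 -> c * c^* = 1.
Proof.
move/phaseP; rewrite !inE => /or4P[] /eqP ->; rewrite ?rmorphN ?rmorph1 ?conjCi.
- exact: mulr1.
- by rewrite mulrNN mulr1.
- by rewrite mulrN -expr2 sqrCi opprK.
- by rewrite mulrNN /= conjCi mulrN -expr2 sqrCi opprK.
Qed.

Lemma phase_neq0 (c : C) : c ^+ 4 = 1 -> c != 0.
Proof. by move=> c4; have := oner_neq0 C; rewrite -c4 expf_eq0. Qed.

Section Monomial.
Variable n : nat.
Local Notation V := 'rV['F_2]_n.
Local Notation op := (operator C n).
Implicit Types (u v w a b m : V) (g : V -> C) (t f : V -> V).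

Definition kernel_op (M : V -> V -> C) : op := \matrix_(i, j) M (bits i) (bits j).

Lemma kernel_op_mul M N :
  kernel_op M *m kernel_op N = kernel_op (fun u v => \sum_w M u w * N w v).
Proof.
apply/matrixP=> i j; rewrite !mxE (reindex _ (onW_bij _ (@enum_rank_bij _))) /=.
by apply: eq_bigr => w _; rewrite !mxE /bits enum_rankK.
Qed.

Lemma eq_kernel_op M N : M =2 N <-> kernel_op M = kernel_op N.
Proof.
split=> [MN|/matrixP MN u v]; first by apply/matrixP=> i j; rewrite !mxE MN.
by have := MN (enum_rank u) (enum_rank v); rewrite !mxE /bits !enum_rankK.
Qed.

Lemma kernel_op_adj M : (kernel_op M)^t* = kernel_op (fun u v => (M v u)^*).
Proof. by apply/matrixP=> i j; rewrite !mxE. Qed.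

Lemma kernel_op1 : 1%:M = kernel_op (fun u v => (u == v)%:R).
Proof. by apply/matrixP=> i j; rewrite !mxE /bits (inj_eq enum_val_inj). Qed.

(* Column [v] of [monomial g t] is supported on the preimage of [v] by [t]:
   the gate sends |t u> to g u |u> when [t] is bijective. *)
Definition monomial g t : op := kernel_op (fun u v => g u * (t u == v)%:R).

Lemma eq_monomial g g' t t' : g =1 g' -> t =1 t' -> monomial g t = monomial g' t'.
Proof. by move=> gg tt; apply/eq_kernel_op => u v; rewrite gg tt. Qed.

Lemma monomial_kernel g t M : monomial g t *m kernel_op M =
  kernel_op (fun u v => g u * M (t u) v).
Proof.
rewrite kernel_op_mul; apply/eq_kernel_op => u v.
rewrite (bigD1 (t u)) //= eqxx mulr1 big1 ?addr0 // => w ne.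
by rewrite eq_sym (negPf ne) mulr0 mul0r.
Qed.

Lemma monomial_mul g g' t t' : monomial g t *m monomial g' t' =
  monomial (fun u => g u * g' (t u)) (t' \o t).
Proof. by rewrite monomial_kernel; apply/eq_kernel_op => u v; rewrite mulrA. Qed.

Lemma scale_monomial c g t : c *: monomial g t = monomial (fun u => c * g u) t.
Proof. by apply/matrixP=> i j; rewrite !mxE mulrA. Qed.

Lemma monomial_inj g g' t t' : (forall u, g u != 0) ->
  monomial g t = monomial g' t' -> g =1 g' /\ t =1 t'.
Proof.
move=> g0 /eq_kernel_op E.
have tt u : t u = t' u.
  have := E u (t u); rewrite eqxx mulr1; case: eqP => [//|_ /eqP].
  by rewrite mulr0 (negPf (g0 u)).
by split=> // u; have := E u (t u); rewrite -tt eqxx !mulr1.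
Qed.

Lemma monomial_unitary g t : (forall u, g u * (g u)^* = 1) -> injective t ->
  monomial g t \is unitarymx.
Proof.
move=> g1 tI; apply/unitarymxP; rewrite {2}/monomial kernel_op_adj monomial_kernel.
rewrite kernel_op1; apply/eq_kernel_op => u v /=.
rewrite eq_sym (inj_eq tI) eq_sym; case: eqP => [->|_].
  by rewrite mulr1 g1.
by rewrite !mulr0 rmorph0 mulr0.
Qed.

Lemma unitary_conj (U P Q : op) : U \is unitarymx ->
  (U *m P *m U^t* = Q) <-> (U *m P = Q *m U).
Proof.
move/unitarymxP=> UU; split=> [<-|->]; last by rewrite -mulmxA UU mulmx1.
by rewrite -[RHS]mulmxA (mulmx1C UU) mulmx1.
Qed.

(** This is c Z^b X^a: it sends |v> to c (-1)^((a + v).b) |a + v>. *)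
Definition pauli_op c a b : op := monomial (fun u => c * chi (dot u b)) (+%R a).

Lemma scale_pauli_op c d a b : c *: pauli_op d a b = pauli_op (c * d) a b.
Proof. by rewrite scale_monomial; apply: eq_monomial => // u; rewrite mulrA. Qed.

Lemma pauli_op_neq0 c b u : c ^+ 4 = 1 -> c * chi (dot u b) != 0.
Proof. by move/phase_neq0/mulf_neq0; apply; apply: chi_neq0. Qed.

Lemma pauli_op_inj c c' a a' b b' : c ^+ 4 = 1 ->
  pauli_op c a b = pauli_op c' a' b' -> [/\ c = c', a = a' & b = b'].
Proof.
move=> c4 /monomial_inj[u|E A]; first exact: pauli_op_neq0.
have cc : c = c' by have := E 0; rewrite !dot0l !chi0 !mulr1.
split=> //; first by have := A 0; rewrite !addr0.
apply/rowP=> i; have := E (delta_mx 0 i); rewrite -cc !dot_delta.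
by move/(mulfI (phase_neq0 c4))/chi_inj.
Qed.

Lemma pauli_factorP (P : 'M[C]_2) :
  (P \in [:: 1%:M; pauliX C; pauliY C; pauliZ C]) ->
  exists k : C, exists x z : 'F_2, k ^+ 4 = 1 /\
    forall i j : 'F_2, P i j = k * chi (i * z) * (x + i == j)%:R.
Proof.
have i4 : (- 'i : C) ^+ 4 = 1 by apply/phaseP; rewrite !inE eqxx !orbT.
rewrite !inE => /or4P[] /eqP ->.
- exists 1, 0, 0; split=> [|i j]; first by rewrite expr1n.
  by rewrite mulr0 chi0 !mul1r add0r mxE.
- exists 1, 1, 0; split=> [|i j]; first by rewrite expr1n.
  by rewrite mulr0 chi0 !mul1r mxE; case: (F2_cases i) => ->; case: (F2_cases j) => ->.
(* Y = -i Z X. *)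
- exists (- 'i), 1, 1; split=> [//|i j].
  by rewrite mxE; case: (F2_cases i) => ->; case: (F2_cases j) => ->;
     rewrite /chi /= ?expr0 ?expr1 ?mulr1 ?mulr0 ?mulrN1 ?opprK.
- exists 1, 0, 1; split=> [|i j]; first by rewrite expr1n.
  by rewrite mxE; case: (F2_cases i) => ->; case: (F2_cases j) => ->;
     rewrite /chi /= ?expr0 ?expr1 ?mulr1 ?mulr0 ?mulrN1 ?opprK ?mul1r.
Qed.

Lemma pauli_factor_exists (x z : 'F_2) : exists2 P : 'M[C]_2,
  P \in [:: 1%:M; pauliX C; pauliY C; pauliZ C] &
  exists2 k : C, k ^+ 4 = 1 &
    forall i j : 'F_2, P i j = k * chi (i * z) * (x + i == j)%:R.
Proof.
have i4 : (- 'i : C) ^+ 4 = 1 by apply/phaseP; rewrite !inE eqxx !orbT.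
case: (F2_cases x) => ->; case: (F2_cases z) => ->.
- exists 1%:M; first by rewrite !inE eqxx.
  exists 1 => [|i j]; first by rewrite expr1n.
  by rewrite mulr0 chi0 !mul1r add0r mxE.
- exists (pauliZ C); first by rewrite !inE eqxx !orbT.
  exists 1 => [|i j]; first by rewrite expr1n.
  by rewrite mxE; case: (F2_cases i) => ->; case: (F2_cases j) => ->;
     rewrite /chi /= ?expr0 ?expr1 ?mulr1 ?mulr0 ?mulrN1 ?opprK ?mul1r.
- exists (pauliX C); first by rewrite !inE eqxx !orbT.
  exists 1 => [|i j]; first by rewrite expr1n.
  by rewrite mulr0 chi0 !mul1r mxE; case: (F2_cases i) => ->; case: (F2_cases j) => ->.
- exists (pauliY C); first by rewrite !inE eqxx !orbT.
  exists (- 'i) => [//|i j].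
  by rewrite mxE; case: (F2_cases i) => ->; case: (F2_cases j) => ->;
     rewrite /chi /= ?expr0 ?expr1 ?mulr1 ?mulr0 ?mulrN1 ?opprK.
Qed.

Lemma tensor_pauli_op (P : 'I_n -> 'M[C]_2) (k : 'I_n -> C) a b :
  (forall l (i j : 'F_2),
     P l i j = k l * chi (i * b 0 l) * (a 0 l + i == j)%:R) ->
  tensor P = pauli_op (\prod_l k l) a b.
Proof.
move=> PE; apply/matrixP => i j; rewrite !mxE.
rewrite (eq_bigr _ (fun l _ => PE l _ _)) !big_split /=; congr (_ * _ * _).
  by rewrite dotE (big_morph chi chiD chi0).
case: eqP => [<-|ne].
  by rewrite big1 // => l _; rewrite mxE eqxx.
have [l nl] : exists l, a 0 l + bits i 0 l != bits j 0 l.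
  apply/existsP; rewrite -negb_forall; apply/negP => /forallP E.
  by apply: ne; apply/rowP => l; rewrite mxE; apply/eqP.
by rewrite (bigD1 l) //= (negPf nl) mul0r.
Qed.

Lemma pauli_groupP (U : op) :
  pauli_group U <-> exists c a b, c ^+ 4 = 1 /\ U = pauli_op c a b.
Proof.
split=> [[c [P [/phaseP c4 PP ->]]]|[c [a [b [c4 ->]]]]].
  have /fin_all_exists[k /fin_all_exists[x /fin_all_exists[z E]]] :=
    fun l => pauli_factorP (PP l).
  exists (c * \prod_l k l), (\row_l x l), (\row_l z l); split.
    by rewrite exprMn c4 -prodrXl big1 ?mulr1 // => l _; case: (E l).
  rewrite (@tensor_pauli_op _ k (\row_l x l) (\row_l z l)); last first.
    by move=> l i j; case: (E l) => _ ->; rewrite !mxE.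
  by rewrite scale_pauli_op.
have /fin_all_exists[P E] : forall l, exists P : 'M[C]_2,
    P \in [:: 1%:M; pauliX C; pauliY C; pauliZ C] /\
    exists k : C, k ^+ 4 = 1 /\
    forall i j : 'F_2, P i j = k * chi (i * b 0 l) * (a 0 l + i == j)%:R.
  move=> l; have [P PP [k k4 E]] := pauli_factor_exists (a 0 l) (b 0 l).
  by exists P; split=> //; exists k.
have /fin_all_exists[k kE] : forall l, exists k : C, k ^+ 4 = 1 /\
    forall i j : 'F_2, P l i j = k * chi (i * b 0 l) * (a 0 l + i == j)%:R.
  by move=> l; case: (E l).
have k4 : (\prod_l k l) ^+ 4 = 1.
  by rewrite -prodrXl big1 // => l _; case: (kE l).
have k0 := phase_neq0 k4.
(* The division cancels the phases carried by the chosen factors, a factor -i for each Y. *)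
exists (c / \prod_l k l), P; split; last 1 first.
- rewrite (@tensor_pauli_op _ k a b); last by move=> l; case: (kE l).
  by rewrite scale_pauli_op divfK.
- by apply/phaseP; rewrite exprMn exprVn k4 c4 invr1 mulr1.
- by move=> l; case: (E l).
Qed.

Lemma pauli_op_pauli c a b : c ^+ 4 = 1 -> pauli_group (pauli_op c a b).
Proof. by move=> c4; apply/pauli_groupP; exists c, a, b. Qed.

Lemma clifford_gateP (U : op) : clifford_gate U <->
  U \is unitarymx /\ forall c a b, c ^+ 4 = 1 -> exists c' a' b',
    c' ^+ 4 = 1 /\ U *m pauli_op c a b = pauli_op c' a' b' *m U.
Proof.
split=> -[Uu UP]; split=> //.
  move=> c a b c4; have /pauli_groupP[c' [a' [b' [c'4]]]] := UP _ (pauli_op_pauli a b c4).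
  by move/(unitary_conj _ _ Uu) => E; exists c', a', b'.
move=> _ /pauli_groupP[c [a [b [c4 ->]]]].
have [c' [a' [b' [c'4 /(unitary_conj _ _ Uu) E]]]] := UP c a b c4.
by apply/pauli_groupP; exists c', a', b'.
Qed.

Lemma clifford_gate_mul (U W : op) :
  clifford_gate U -> clifford_gate W -> clifford_gate (U *m W).
Proof.
move=> /clifford_gateP[Uu UP] /clifford_gateP[Wu WP]; apply/clifford_gateP.
split=> [|x a b x4]; first exact: mul_unitarymx.
have [x' [a' [b' [x'4 E1]]]] := WP x a b x4.
have [x'' [a'' [b'' [x''4 E2]]]] := UP x' a' b' x'4.
by exists x'', a'', b''; split=> //; rewrite -mulmxA E1 !mulmxA E2.
Qed.

(** Conjugation by U acts on the finite set of Paulis modulo phase. The action is injective, since U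
    is invertible and distinct pairs (a, b) give non-proportional Paulis; hence it is surjective. *)
Lemma clifford_preimage (U : op) : clifford_gate U ->
  forall a b, exists c a' b', c ^+ 4 = 1 /\
    U *m pauli_op 1 a' b' = pauli_op c a b *m U.
Proof.
move=> /clifford_gateP[Uu UP].
have Uunit := unitarymx_unit Uu.
have /fin_all_exists[s sE] : forall p : V * V, exists q : V * V, exists c : C,
    c ^+ 4 = 1 /\ U *m pauli_op 1 p.1 p.2 = pauli_op c q.1 q.2 *m U.
  move=> p; have [c [a [b [c4 E]]]] := UP 1 p.1 p.2 (expr1n _ _).
  by exists (a, b), c.
have sI : injective s.
  move=> p q spq; have [c [c4 cE]] := sE p; have [d [d4 dE]] := sE q.
  have : c^-1 *: pauli_op 1 p.1 p.2 = d^-1 *: pauli_op 1 q.1 q.2.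
    apply: (can_inj (mulKmx Uunit)); rewrite -!scalemxAr cE dE -spq !scalemxAl.
    by rewrite !scale_pauli_op !mulVf ?phase_neq0.
  rewrite !scale_pauli_op !mulr1.
  case/pauli_op_inj; first by rewrite exprVn c4 invr1.
  by move=> _ E1 E2; case: p q E1 E2 {spq cE dE} => [p1 p2] [q1 q2] /= -> ->.
move=> a b; have /codomP[p E] := injF_onto sI (a, b).
by have [c [c4 cE]] := sE p; rewrite -E in cE; exists c, p.1, p.2.
Qed.

(** Affinity of t makes the permutation part carry translations to translations. The condition on g
    says that its multiplicative derivatives are characters up to phase, as for signs with a
    quadratic exponent. *)
Lemma monomial_clifford g t : injective t ->
  (forall u v, t (u + v) = t u + t v + t 0) ->
  (forall u, g u * (g u)^* = 1) ->
  (forall m, exists c b, c ^+ 4 = 1 /\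
     forall u, g u = c * chi (dot u b) * g (m + u)) ->
  clifford_gate (monomial g t).
Proof.
move=> tI tA g1 gQ; apply/clifford_gateP; split; first exact: monomial_unitary.
move=> c a b c4.
(* The translation by a, pulled back along t, is the translation by the m with t m = a + t 0. *)
have /codomP[m mE] := injF_onto tI (a + t 0).
have tm u : a + t u = t (m + u).
  by rewrite tA -mE addrAC addvK.
have [c' [b' [c'4 gE]]] := gQ m.
have [b'' bE] : exists b'', forall u, dot (t u + t 0) b = dot u b''.
  apply: (additive_dot (h := fun u => dot (t u + t 0) b)) => u v.
  by rewrite -dotDl tA addvK addrACA add2v addr0.
exists (c' * c * chi (dot (t 0) b)), m, (b' + b''); split.
  by rewrite !exprMn c'4 c4 !mul1r chi_phase.
rewrite !monomial_mul; apply: eq_monomial => u /=; last by rewrite tm.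
rewrite gE dotDr chiD -bE dotDl chiD.
have := chi_sqr (dot (t 0) b); move: (chi _) (chi _) (chi _) => x y z zz.
by rewrite -[LHS]mulr1 -zz; ring.
Qed.

End Monomial.
End Operators.

(** * The product attached to a permutation *)

Section Subspaces.
Variable n : nat.
Local Notation V := 'rV['F_2]_n.

Lemma F2_span_ind (P : V -> Prop) : P 0 -> (forall u v, P u -> P v -> P (u + v)) ->
  (forall i, P (delta_mx 0 i)) -> forall u, P u.
Proof.
move=> P0 PD Pd u; rewrite [u]row_sum_delta; apply: (big_ind P) => // i _.
by case: (F2_cases (u 0 i)) => ->; rewrite ?scale0r ?scale1r.
Qed.

Lemma F2_subspace_coordinates (S : {set V}) :
  0 \in S -> {in S &, forall u v, u + v \in S} ->
  exists2 A : 'M['F_2]_n, A \in unitmx &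
    exists2 k, (k <= n)%N & forall u, (u \in S) = (u *m A *m pid_mx k == u *m A).
Proof.
(* The rows of M are all the elements of S, so its row space is S. Gaussian elimination then carries
   S to the span of the first \rank M basis vectors. *)
move=> S0 SD; pose M : 'M_(#|S|, n) := \matrix_i enum_val i.
exists (invmx (row_ebase M)); first by rewrite unitmx_inv row_ebase_unit.
exists (\rank M) => [|u]; first exact: rank_leq_col.
have SM : (u \in S) = (u <= M)%MS.
  apply/idP/submxP => [uS|[D ->]].
    exists (delta_mx 0 (enum_rank_in uS u)).
    by rewrite -rowE rowK enum_rankK_in.
  rewrite mulmx_sum_row; apply: (big_ind (fun x => x \in S)) => // i _.
  by case: (F2_cases (D 0 i)) => ->; rewrite ?scale0r ?scale1r // rowK enum_valP.
rewrite SM; apply/submxP/eqP => [[D ->]|E].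
  rewrite -[X in D *m X]mulmx_ebase !mulmxA mulmxK ?row_ebase_unit //.
  by rewrite -[LHS]mulmxA pid_mx_id ?rank_leq_col.
exists (u *m invmx (row_ebase M) *m pid_mx (\rank M) *m invmx (col_ebase M)).
rewrite -[X in _ *m X]mulmx_ebase !mulmxA mulmxKV ?col_ebase_unit //.
rewrite -[X in X *m _]mulmxA pid_mx_id ?rank_leq_row // E.
by rewrite mulmxKV ?row_ebase_unit.
Qed.

Lemma delta_pid_mx k (i : 'I_n) :
  delta_mx 0 i *m pid_mx k = (if (i < k)%N then delta_mx 0 i else 0) :> V.
Proof.
rewrite -rowE; apply/rowP=> j; case: ifP => ik; rewrite !mxE /= ik ?andbT ?andbF //.
by rewrite eq_sym.
Qed.

End Subspaces.

(** * Commutative associative products over F_2 with zero squares *)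

Section SquareZeroProduct.
Variable n : nat.
Local Notation V := 'rV['F_2]_n.
Variable vmul : V -> V -> V.
Local Infix "**" := vmul (at level 40, left associativity).
Hypothesis vmulC : forall u v, u ** v = v ** u.
Hypothesis vmulDl : forall u v w, (u + v) ** w = u ** w + v ** w.
Hypothesis vmulA : forall u v w, u ** v ** w = u ** (v ** w).
Hypothesis vmulvv : forall u, u ** u = 0.

Let vmul0l u : 0 ** u = 0.
Proof. by rewrite -[RHS](add2v (0 ** u)) -vmulDl addr0. Qed.

Let vmul0r u : u ** 0 = 0.
Proof. by rewrite vmulC vmul0l. Qed.

Lemma vmulZl (x : 'F_2) u v : (x *: u) ** v = x *: (u ** v).
Proof. by case: (F2_cases x) => ->; rewrite ?scale0r ?scale1r ?vmul0l. Qed.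

Lemma vmulCA u v w : u ** (v ** w) = v ** (u ** w).
Proof. by rewrite -!vmulA (vmulC u). Qed.

Lemma vmul_vvu u v : u ** (u ** v) = 0.
Proof. by rewrite -vmulA vmulvv vmul0l. Qed.

Lemma vmul_vwv u v : u ** (v ** u) = 0.
Proof. by rewrite vmulC vmulA vmulvv vmul0r. Qed.

(* A relation is multiplied by complementary monomials, in order of increasing
   degree. *)
Lemma monomials_independent a b c p (x0 x1 x2 x3 x4 x5 x6 : 'F_2) :
  a ** b ** c = p -> p != 0 ->
  x0 *: a + (x1 *: b + (x2 *: c + (x3 *: (a ** b) + (x4 *: (a ** c) +
    (x5 *: (b ** c) + x6 *: p))))) = 0 ->
  [/\ x0 = 0, x1 = 0, x2 = 0, x3 = 0 & [/\ x4 = 0, x5 = 0 & x6 = 0]].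
Proof.
move=> pE p0 E.
have mulE w : x0 *: (a ** w) + (x1 *: (b ** w) + (x2 *: (c ** w) +
    (x3 *: (a ** b ** w) + (x4 *: (a ** c ** w) + (x5 *: (b ** c ** w) +
     x6 *: (p ** w)))))) = 0.
  by have := congr1 (fun z => z ** w) E; rewrite vmul0l !vmulDl !vmulZl.
have scale_p0 (y : 'F_2) : y *: p = 0 -> y = 0.
  by move/eqP; rewrite scaler_eq0 (negPf p0) orbF => /eqP.
have abc : a ** (b ** c) = p by rewrite -vmulA.
have bac : b ** (a ** c) = p by rewrite vmulCA.
have cab : c ** (a ** b) = p by rewrite vmulC.
have pa : p ** a = 0 by rewrite vmulC -abc vmul_vvu.
have pb : p ** b = 0 by rewrite vmulC -bac vmul_vvu.
have pc : p ** c = 0 by rewrite vmulC -cab vmul_vvu.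
have pv v w : p ** v = 0 -> p ** (v ** w) = 0 by rewrite -vmulA => ->; rewrite vmul0l.
have simpE := (vmulA, vmul_vvu, vmul_vwv, vmulvv, vmul0r, scaler0, add0r, addr0).
have y0 : x0 = 0.
  apply: scale_p0; have := mulE (b ** c).
  by rewrite abc (pv _ _ pb) !simpE.
have y1 : x1 = 0.
  apply: scale_p0; have := mulE (a ** c).
  rewrite y0 scale0r add0r bac.
  by rewrite (pv _ _ pa) !simpE (vmulCA b a) !simpE.
have y2 : x2 = 0.
  apply: scale_p0; have := mulE (a ** b).
  rewrite y0 y1 !scale0r !add0r cab.
  by rewrite (pv _ _ pa) !simpE (vmulCA c a) !simpE (vmulCA b a) !simpE.
have y3 : x3 = 0.
  apply: scale_p0; have := mulE c.
  by rewrite y0 y1 y2 !scale0r !add0r pc !simpE abc.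
have y4 : x4 = 0.
  apply: scale_p0; have := mulE b.
  by rewrite y0 y1 y2 y3 !scale0r !add0r pb !simpE (vmulC c) abc.
have y5 : x5 = 0.
  apply: scale_p0; have := mulE a.
  by rewrite y0 y1 y2 y3 y4 !scale0r !add0r pa !simpE (vmulC c) bac.
have y6 : x6 = 0.
  by apply: scale_p0; move: E; rewrite y0 y1 y2 y3 y4 y5 !scale0r !add0r.
by [].
Qed.

(** Otherwise the seven monomials in a, b, c are the independent rows of a matrix with fewer than
    seven columns. *)
Lemma vmul3_eq0 a b c : (n < 7)%N -> a ** b ** c = 0.
Proof.
move=> n7; apply/eqP/negPn/negP => p0.
pose s := [:: a; b; c; a ** b; a ** c; b ** c; a ** b ** c].
pose M : 'M['F_2]_(7, n) := \matrix_(i < 7) nth 0 s i.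
suff : row_free M.
  by rewrite /row_free => /eqP rM; move: (rank_leq_col M); rewrite rM leqNgt n7.
rewrite -kermx_eq0; apply/eqP/row_matrixP => i; rewrite row0.
have : row i (kermx M) *m M = 0 by apply/sub_kermxP; apply: row_sub.
move: (row i (kermx M)) => x; rewrite mulmx_sum_row !big_ord_recl big_ord0 !rowK /=.
rewrite addr0 => /(monomials_independent erefl p0)[y0 y1 y2 y3 [y4 y5 y6]].
apply/rowP => j; rewrite [RHS]mxE.
case: j => [[|[|[|[|[|[|[|//]]]]]]] lt];
  [rewrite -[RHS]y0 | rewrite -[RHS]y1 | rewrite -[RHS]y2 | rewrite -[RHS]y3
  | rewrite -[RHS]y4 | rewrite -[RHS]y5 | rewrite -[RHS]y6];
  congr (x _ _); exact: val_inj.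
Qed.

End SquareZeroProduct.

(** * The group law transported by a permutation and its bilinear part *)

Section CircleProduct.
Variable n : nat.
Local Notation V := 'rV['F_2]_n.
Variable f : V -> V.
Hypothesis f_inj : injective f.
Hypothesis f_affine : forall a, exists t : V -> V,
  (forall u v, t (u + v) = t u + t v + t 0) /\ (forall u, f (t u) = f u + a).

(** With h u = f u + f 0 this is the solution of h (circ u v) = h u + h v. Subtracting f 0 makes 0
    the neutral element. *)
Definition circ u v : V := finv f (f u + f v + f 0).
Definition vmul u v : V := circ u v + u + v.
Local Infix "**" := vmul (at level 40, left associativity).

Lemma f_circ u v : f (circ u v) = f u + f v + f 0.
Proof. exact: f_finv. Qed.

Lemma circE u v : circ u v = u + v + u ** v.
Proof. rewrite /vmul; move: (circ u v) => w; addv_solve. Qed.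

Lemma circ0 u : circ u 0 = u.
Proof. by apply: f_inj; rewrite f_circ addvK. Qed.

Lemma circC u v : circ u v = circ v u.
Proof. by apply: f_inj; rewrite !f_circ (addrC (f u)). Qed.

Lemma circA u v w : circ (circ u v) w = circ u (circ v w).
Proof.
apply: f_inj; rewrite !f_circ.
move: (f u) (f v) (f w) (f 0) => x y z t; addv_solve.
Qed.

Lemma circvv u : circ u u = 0.
Proof. by apply: f_inj; rewrite f_circ add2v add0r. Qed.

(** Right translation by w is u |-> f^-1 (f u + (f w + f 0)), one of the maps that are affine by
    hypothesis; its value at 0 is w. *)
Lemma circDl u v w : circ (u + v) w = circ u w + circ v w + w.
Proof.
have [t [tA tE]] := f_affine (f w + f 0).
have circt x : circ x w = t x by apply: f_inj; rewrite f_circ tE addrA.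
by rewrite !circt tA -(circt 0) circC circ0.
Qed.

Lemma vmulC u v : u ** v = v ** u.
Proof. by rewrite /vmul circC addrAC. Qed.

Lemma vmulDl u v w : (u + v) ** w = u ** w + v ** w.
Proof. rewrite /vmul circDl; move: (circ u w) (circ v w) => x y; addv_solve. Qed.

Lemma vmulDr u v w : w ** (u + v) = w ** u + w ** v.
Proof. by rewrite !(vmulC w) vmulDl. Qed.

Lemma vmul0l u : 0 ** u = 0.
Proof. by rewrite /vmul circC circ0 addr0 add2v. Qed.

Lemma vmulvv u : u ** u = 0.
Proof. by rewrite /vmul circvv add0r add2v. Qed.

(** When [circA] is expanded by bilinearity, all terms except the two triple products cancel. *)
Lemma vmulA u v w : u ** v ** w = u ** (v ** w).
Proof.
have := circA u v w; rewrite !circE !vmulDl !vmulDr.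
move: (u ** v ** w) (u ** (v ** w)) (u ** v) (u ** w) (v ** w).
by move=> p q x y z /eq_addv0 E; apply: addv_eq0; rewrite -[RHS]E; addv_solve.
Qed.

Hypothesis n_lt7 : (n < 7)%N.

Definition annihilator : {set V} := [set x | [forall u, x ** u == 0]].
Local Notation h u := (f u + f 0).

Lemma annihilatorP x : reflect (forall u, x ** u = 0) (x \in annihilator).
Proof. by rewrite inE; apply: (iffP forallP) => H u; apply/eqP. Qed.

Lemma vmul_annihilator u v : u ** v \in annihilator.
Proof. by apply/annihilatorP => w; apply: (vmul3_eq0 vmulC vmulDl vmulA vmulvv). Qed.

(** Triple products vanish, so u + v and u ** v have zero product and their circle product is u + v
    + u ** v = circ u v. Applying the homomorphism h to both forms gives the identity. *)
Lemma h_add u v : h (u + v) = h u + h v + h (u ** v).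
Proof.
have : f (circ (u + v) (u ** v)) = f (circ u v).
  congr f; rewrite !circE (vmulC (u + v)) (annihilatorP _ (vmul_annihilator u v)).
  by rewrite addr0.
rewrite !f_circ; move: (f _) (f u) (f v) (f (u ** v)) (f 0) => x y z t w.
by move=> /eq_addv0 E; apply: addv_eq0; rewrite -[RHS]E; addv_solve.
Qed.

Lemma h_add_annihilator u v : u \in annihilator -> h (u + v) = h u + h v.
Proof. by move/annihilatorP=> uA; rewrite h_add uA add2v addr0. Qed.

(** The coordinates A make the annihilator the range of a coordinate projection E. There h is
    additive, and its failure to be additive elsewhere lies in the image of the annihilator, so h is
    a linear map L after a shear along that range. *)
Lemma shear_decomposition : exists A L E : 'M['F_2]_n, exists q : V -> V,
  [/\ A \in unitmx, L \in unitmx, E *m E = E /\ E^T = E,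
      (forall u, q u *m E = q u) /\ (forall u v, q (u + v *m E) = q u)
    & forall u, f u = (u *m A + q (u *m A)) *m L + f 0].
Proof.
have S0 : 0 \in annihilator by apply/annihilatorP => u; apply: vmul0l.
have SD : {in annihilator &, forall u v, u + v \in annihilator}.
  move=> u v /annihilatorP Su /annihilatorP Sv; apply/annihilatorP => w.
  by rewrite vmulDl Su Sv addr0.
have [A Au [k kn SE]] := F2_subspace_coordinates S0 SD.
have [E [EE Esym Edelta ES]] : exists E : 'M['F_2]_n, [/\ E *m E = E, E^T = E,
    forall i, delta_mx 0 i *m E = delta_mx 0 i :> V \/ delta_mx 0 i *m E = 0 :> V
    & forall u, (u \in annihilator) = (u *m A *m E == u *m A)].
  exists (pid_mx k); split=> //; [exact: pid_mx_id | exact: tr_pid_mx |] => i.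
  by rewrite delta_pid_mx; case: ifP; [left | right].
have mulEE (u : V) : u *m E *m E = u *m E by rewrite -mulmxA EE.
(* g is h in the new coordinates; it is kept abstract so that only the equations below are used. *)
have [g gE] : exists g : V -> V, forall w, g w = h (w *m invmx A).
  by exists (fun w => h (w *m invmx A)).
have SV w : w *m E *m invmx A \in annihilator by rewrite ES mulmxKV // mulEE.
have g0 : g 0 = 0 by rewrite gE mul0mx add2v.
have gD u v : exists2 s, s *m E = s & g (u + v) = g u + g v + g s.
  exists ((u *m invmx A) ** (v *m invmx A) *m A).
    by apply/eqP; rewrite -ES; apply: vmul_annihilator.
  by rewrite !gE mulmxDl h_add mulmxK.
have gDS u v : g (u *m E + v) = g (u *m E) + g v.
  by rewrite !gE mulmxDl h_add_annihilator.
(* L is the linear map that agrees with g on the standard basis. It then agrees with g on the range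
   of E, which is spanned by basis vectors. *)
have [L LE] : exists L : 'M['F_2]_n, forall i, delta_mx 0 i *m L = g (delta_mx 0 i).
  by exists (\matrix_i g (delta_mx 0 i)) => i; rewrite -rowE rowK.
have gS u : g (u *m E) = u *m E *m L.
  elim/F2_span_ind: u => [|u v IHu IHv|i]; first by rewrite !mul0mx.
    by rewrite mulmxDl gDS IHu IHv [RHS]mulmxDl.
  by have [->|->] := Edelta i; rewrite ?mul0mx.
(* Each addition contributes an error g s with s in the range of E, and there g is L. *)
have gL u : exists s, g u = u *m L + s *m E *m L.
  elim/F2_span_ind: u => [|u v [s IHu] [t IHv]|i].
  - by exists 0; rewrite g0 !mul0mx addr0.
  - have [r rE gr] := gD u v; exists (s + t + r).
    rewrite gr IHu IHv -[in g r]rE gS.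
    rewrite (mulmxDl (s + t)) (mulmxDl s) !(mulmxDl _ _ L).
    by rewrite addrACA [RHS]addrA.
  - by exists 0; rewrite !mul0mx addr0.
have gI : injective g.
  by move=> u v; rewrite !gE => /addIr/f_inj; apply: (can_inj (mulmxKV Au)).
(* If u L = 0, then g u = g (s E), so u = s E lies where g and L agree; hence g u = 0 and u = 0. *)
have Lu : L \in unitmx.
  rewrite -row_free_unit -kermx_eq0; apply/eqP/row_matrixP => i; rewrite row0.
  have : row i (kermx L) *m L = 0 by apply/sub_kermxP; apply: row_sub.
  move: (row i _) => u uL; have [s] := gL u; rewrite uL add0r -gS => /gI us.
  by apply: gI; rewrite us gS -us uL g0.
(* The shear term is the deviation of g from L, pulled back by L. It lies in the range of E by [gL],
   and translation by that range does not change it because g and L agree there. *)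
exists A, L, E, (fun w => (g w + w *m L) *m invmx L).
split=> // [|u]; last first.
  rewrite mulmxDl mulmxKV // gE mulmxK //.
  by rewrite (addrC _ (u *m A *m L)) addKv addvK.
split=> [u|u v].
  by have [s ->] := gL u; rewrite (addrC (u *m L)) addvK mulmxK.
congr (_ *m _); rewrite (addrC u) gDS gS mulmxDl addrACA.
by rewrite add2v add0r.
Qed.
End CircleProduct.

(** * At most six qubits *)

Section PermutationGates.
Variables (C : numClosedFieldType) (n : nat).
Local Notation V := 'rV['F_2]_n.
Local Notation op := (operator C n).

(** The gate sends |f u> to |u>. Products therefore compose in reverse order, and conjugating X^a
    gives the map f^-1 (f u + a). *)
Definition perm_op (f : V -> V) : op := monomial (fun=> 1) f.

Lemma perm_op_mul f g : perm_op f *m perm_op g = perm_op (g \o f).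
Proof. by rewrite monomial_mul; apply: eq_monomial => u //=; rewrite mulr1. Qed.

Lemma eq_perm_op f g : f =1 g -> perm_op f = perm_op g.
Proof. exact: eq_monomial. Qed.

Lemma perm_op_unitary f : injective f -> perm_op f \is unitarymx.
Proof. by apply: monomial_unitary => u; rewrite rmorph1 mulr1. Qed.

Lemma permutation_gateP (U : op) : permutation_gate U <->
  exists2 f, injective f & U = perm_op f.
Proof.
split=> [[_ /is_perm_mxP[s ->]]|[f fI ->]].
  exists (fun u => bits (s (enum_rank u))).
    by move=> u v /enum_val_inj/perm_inj/enum_rank_inj.
  apply/matrixP => i j.
  by rewrite !mxE /bits enum_valK mul1r (inj_eq enum_val_inj).
split; first exact: perm_op_unitary.
have sI : injective (fun i : 'I_#|{: V}| => enum_rank (f (bits i))).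
  by move=> i j /enum_rank_inj/fI/enum_val_inj.
apply/is_perm_mxP; exists (perm sI); apply/matrixP => i j.
rewrite !mxE permE mul1r /bits -[j in RHS]enum_valK.
by rewrite (inj_eq enum_rank_inj).
Qed.

Lemma perm_op_clifford f : injective f ->
  (forall u v, f (u + v) = f u + f v + f 0) -> clifford_gate (perm_op f).
Proof.
move=> fI fA; apply: monomial_clifford => // [u|m]; first by rewrite rmorph1 mulr1.
exists 1, 0; split=> [|u]; first exact: expr1n.
by rewrite dot0r chi0 !mulr1.
Qed.

Lemma affine_mx_clifford (A : 'M['F_2]_n) (c : V) : A \in unitmx ->
  clifford_gate (perm_op (fun u => u *m A + c)).
Proof.
move=> Au; apply: perm_op_clifford => [|u v].
  by apply: (can_inj (g := fun u => (u + c) *m invmx A)) => u; rewrite addvK mulmxK.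
by rewrite mulmxDl mul0mx; addv_solve.
Qed.

Lemma conj_pauli_op (f t : V -> V) c a b : injective f ->
    (forall u, f (t u) = f u + a) ->
  perm_op f *m pauli_op c a b *m (perm_op f)^t* =
  monomial (fun u => c * chi C (dot (f u) b)) t.
Proof.
move=> fI tE; apply/unitary_conj; first exact: perm_op_unitary.
rewrite !monomial_mul; apply: eq_monomial => u /=; first by rewrite mulr1 mul1r.
by rewrite tE addrC.
Qed.

Lemma perm_op_third_level f a : injective f -> clifford_hierarchy 3 (perm_op f) ->
  exists t : V -> V,
    (forall u v, t (u + v) = t u + t v + t 0) /\ (forall u, f (t u) = f u + a).
Proof.
move=> fI [_ C3]; pose t u := finv f (f u + a).
have tE u : f (t u) = f u + a by rewrite f_finv.
have tI : injective t by move=> u v /(congr1 f); rewrite !tE => /addIr/fI.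
exists t; split=> // u v.
have /clifford_gateP[_ Ct] := C3 _ (pauli_op_pauli a 0 (expr1n _ _)).
(* X^d is conjugated to X^a', so t (_ + a') = t _ + d; take d = t v + t 0. *)
have [c [a' [b' [c4]]]] := Ct 1 (t v + t 0) 0 (expr1n _ _).
rewrite (conj_pauli_op _ _ fI tE) !monomial_mul => /esym/monomial_inj[w|_ E].
  by rewrite mul1r dot0r chi0 mulr1 pauli_op_neq0.
have a'v : a' = v.
  by apply: tI; have := E 0; rewrite /= addr0 addvK.
by have := E u; rewrite /= a'v addrC => ->; addv_solve.
Qed.

(** * Hadamard transform along the range of a symmetric projection *)

Section PartialHadamard.
Variable E : 'M['F_2]_n.
Hypothesis EE : E *m E = E.
Hypothesis Esym : E^T = E.

Let mulEE (u : V) : u *m E *m E = u *m E. Proof. by rewrite -mulmxA EE. Qed.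
Let dotE' u v : dot (u *m E) v = dot u (v *m E).
Proof. by rewrite dot_mulmxl Esym. Qed.

(** Since E is idempotent, the kernel of 1 + E is the range of E; these are the cosets of that
    range. *)
Definition same_coset (u v : V) := u + u *m E == v + v *m E.

Lemma same_cosetP u v : same_coset u v -> u = v + (u + v) *m E.
Proof.
rewrite mulmxDl /same_coset => /eqP/eq_addv0 H.
by apply: addv_eq0; rewrite -[RHS]H; addv_solve.
Qed.

Definition coset_size : C := \sum_w (same_coset w 0)%:R.

Lemma coset_size_gt0 : 0 < coset_size.
Proof.
rewrite /coset_size (bigD1 0) //= /same_coset eqxx ltr_pwDl ?ltr01 //.
by apply: sumr_ge0 => w _; apply: ler0n.
Qed.

(** Orthogonality of characters on a coset: if y E has i-th coordinate 1, translation by e_i E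
    preserves the coset and flips every sign, so the sum is its own opposite. *)
Lemma character_sum z y : \sum_w (same_coset w z)%:R * chi C (dot w (y *m E)) =
  (y *m E == 0)%:R * coset_size.
Proof.
case: eqP => [->|/eqP yE].
  rewrite mul1r (reindex_inj (addrI z)); apply: eq_bigr => w _.
  rewrite dot0r chi0 mulr1 /same_coset mulmxDl mul0mx addr0; congr (_%:R).
  by rewrite addrACA -[X in _ == X]addr0 (inj_eq (addrI _)).
rewrite mul0r; have [i yi] : exists i, (y *m E) 0 i = 1.
  have /rV0Pn[i yi] := yE; exists i; have [y0|//] := F2_cases ((y *m E) 0 i).
  by rewrite y0 eqxx in yi.
set S := \sum_w _.
have : S = - S.
  rewrite {1}/S (reindex_inj (addrI (delta_mx 0 i *m E))) -sumrN.
  apply: eq_bigr => w _; rewrite dotDl chiD dotE' mulEE dot_delta yi.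
  rewrite chi1 mulN1r mulrN.
  suff -> : same_coset (delta_mx 0 i *m E + w) z = same_coset w z by [].
  by rewrite /same_coset mulmxDl mulEE addrACA add2v add0r.
by move/eqP; rewrite -addr_eq0 -mulr2n mulrn_eq0 => /eqP.
Qed.

(** When E projects onto a set of coordinates, this is the tensor product of Hadamard gates on those
    coordinates and identities on the others. *)
Definition hadamard : op := kernel_op (fun u v =>
  (sqrtC coset_size)^-1 * ((same_coset u v)%:R * chi C (dot u (v *m E)))).

Lemma norm_const : (sqrtC coset_size)^-1 * (sqrtC coset_size)^-1 * coset_size = 1.
Proof. by rewrite -expr2 exprVn sqrtCK mulVf // gt_eqF // coset_size_gt0. Qed.

(* A shear along the range of [E] is diagonal in the basis obtained by a
   Fourier transform of that range. *)
Lemma hadamard_shear q : (forall u, q u *m E = q u) ->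
    (forall u v, q (u + v *m E) = q u) ->
  hadamard *m monomial (fun u => chi C (dot u (q u))) id *m hadamard =
  perm_op (fun u => u + q u).
Proof.
move=> qE qD; rewrite -mulmxA monomial_kernel kernel_op_mul.
apply/eq_kernel_op => u v.
(* The intermediate index w stays in the coset of u, where q is constant. The exponent u.wE + w.q(w)
   + w.vE is thus linear in w. *)
transitivity ((sqrtC coset_size)^-1 * (sqrtC coset_size)^-1 * ((same_coset u v)%:R *
   \sum_w (same_coset w u)%:R * chi C (dot w ((u + q u + v) *m E)))).
  rewrite !mulr_sumr; apply: eq_bigr => w _.
  have sC : same_coset u w = same_coset w u by rewrite /same_coset eq_sym.
  rewrite sC; case: (boolP (same_coset w u)) => wu; last by rewrite !(mul0r, mulr0).
  have qw : q w = q u by rewrite (same_cosetP wu) qD.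
  have -> : same_coset w v = same_coset u v by rewrite /same_coset (eqP wu).
  rewrite qw !mulmxDl qE !dotDr !chiD (dotC w (u *m E)) dotE' !mul1r.
  by ring.
rewrite character_sum mul1r.
transitivity ((same_coset u v && ((u + q u + v) *m E == 0))%:R : C).
  rewrite -mulnb natrM -[RHS]mulr1 -[X in _ = _ * X]norm_const.
  move: (_ == 0) => r; move: (same_coset u v) => s.
  move: (sqrtC _)^-1 => N; move: coset_size (r%:R) (s%:R) => K x y.
  by ring.
congr ((nat_of_bool _)%:R); apply/andP/eqP => [[uv /eqP H]|<-].
  have /eqP/eq_addv0 := uv; move: H; rewrite !mulmxDl qE => H1 H2.
  by apply: addv_eq0; rewrite -[RHS]H1 -[RHS]addr0 -[X in _ = _ + X]H2; addv_solve.
rewrite add2v mul0mx /same_coset mulmxDl qE; split=> //.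
by apply/eqP; addv_solve.
Qed.

Lemma hadamard_sqr : hadamard *m hadamard = 1%:M.
Proof.
have := @hadamard_shear (fun=> 0) (fun=> mul0mx _ _) (fun _ _ => erefl).
have -> : monomial (fun u : V => chi C (dot u 0)) id = 1%:M.
  by rewrite kernel_op1; apply/eq_kernel_op => u v; rewrite dot0r mul1r.
have -> : perm_op (fun u => u + 0) = 1%:M.
  by rewrite kernel_op1; apply/eq_kernel_op => u v; rewrite addr0 mul1r.
by rewrite mulmx1.
Qed.

Lemma hadamard_adj : hadamard^t* = hadamard.
Proof.
rewrite kernel_op_adj; apply/eq_kernel_op => u v /=.
rewrite !rmorphM /= chi_conj rmorph_nat fmorphV /= geC0_conj; last first.
  by rewrite sqrtC_ge0 ltW // coset_size_gt0.
by rewrite dotC dotE' /same_coset eq_sym.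
Qed.

Lemma hadamard_clifford : clifford_gate hadamard.
Proof.
apply/clifford_gateP; split.
  by apply/unitarymxP; rewrite hadamard_adj hadamard_sqr.
(* X and Z are exchanged along the range of E and kept elsewhere. The sign comes from reordering
   X^(bE) Z^(aE). *)
move=> c a b c4; exists (c * chi C (dot (a *m E) b)).
exists (a + a *m E + b *m E), (a *m E + b + b *m E); split.
  by rewrite exprMn c4 chi_phase mulr1.
rewrite monomial_kernel kernel_op_mul; apply/eq_kernel_op => u v.
rewrite (bigD1 (a + v)) //= big1 ?addr0 => [|w ne]; last first.
  case: eqP => [wv|_]; last by rewrite !mulr0.
  by rewrite -wv addKv eqxx in ne.
rewrite addKv eqxx mulr1.
have -> : same_coset (a + a *m E + b *m E + u) v = same_coset u (a + v).
  rewrite /same_coset !mulmxDl !mulEE.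
  apply/eqP/eqP => /eq_addv0 H; apply: addv_eq0; rewrite -[RHS]H; addv_solve.
case: (boolP (same_coset u (a + v))) => [uv|_]; last by rewrite !(mul0r, mulr0).
rewrite !mul1r.
have vE : v = u + u *m E + a + a *m E + v *m E.
  move: uv => /eqP/eq_addv0; rewrite mulmxDl => H.
  by apply: addv_eq0; rewrite -[RHS]H; addv_solve.
have phaseE : chi C (dot u ((a + v) *m E)) * chi C (dot (a + v) b) =
   chi C (dot (a *m E) b) * (chi C (dot u (a *m E + b + b *m E)) *
   chi C (dot (a + a *m E + b *m E + u) (v *m E))).
  rewrite -!chiD; congr chi.
  rewrite [in dot (a + v) b]vE mulmxDl !(dotDl, dotDr) !dotE' !mulEE.
  rewrite !(dotC v) !dotE'.
  by F2_ring.
move: (sqrtC _)^-1 => N; move: phaseE.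
move: (chi C (dot u ((a + v) *m E))) (chi C (dot (a + v) b)) => x1 x2.
move: (chi C _) (chi C _) (chi C _) => x3 x4 x5 E1.
by transitivity (N * c * (x1 * x2)); [ring | rewrite E1; ring].
Qed.
End PartialHadamard.

Lemma shear_semi_clifford (A L E : 'M['F_2]_n) (q : V -> V) (c : V) :
    A \in unitmx -> L \in unitmx -> E *m E = E -> E^T = E ->
    (forall u, q u *m E = q u) -> (forall u v, q (u + v *m E) = q u) ->
  semi_clifford (perm_op (fun u => (u *m A + q (u *m A)) *m L + c)).
Proof.
move=> Au Lu EE Esym qE qD.
have Hc := hadamard_clifford EE Esym.
exists (perm_op (fun u => u *m A + 0) *m hadamard E).
exists (monomial (fun u => chi C (dot u (q u))) id).
exists (hadamard E *m perm_op (fun u => u *m L + c)).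
split.
- by apply: clifford_gate_mul Hc; apply: affine_mx_clifford.
- split.
    by apply: monomial_unitary => // u; rewrite chi_conj chi_sqr.
  apply/is_diag_mxP => i j ij; rewrite !mxE (inj_eq enum_val_inj).
  case: eqP => [ij'|_]; last by rewrite mulr0.
  by rewrite ij' eqxx in ij.
- by apply: clifford_gate_mul => //; apply: affine_mx_clifford.
rewrite !mulmxA -(mulmxA (perm_op _) (hadamard E)) -(mulmxA (perm_op _)).
rewrite hadamard_shear // !perm_op_mul.
by apply: eq_perm_op => u /=; rewrite addr0.
Qed.

Lemma third_level_semi_clifford (U : op) : (n < 7)%N ->
  permutation_gate U -> clifford_hierarchy 3 U -> semi_clifford U.
Proof.
move=> n7 /permutation_gateP[f fI ->] C3.
have [A [L [E [q [Au Lu [EE Esym] [qE qD] fE]]]]] :=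
  shear_decomposition fI (fun a => perm_op_third_level a fI C3) n7.
by rewrite (eq_perm_op fE); apply: shear_semi_clifford EE Esym qE qD.
Qed.
End PermutationGates.

(** * Seven qubits *)

Section ThirdLevel.
Variables (C : numClosedFieldType) (n : nat).
Local Notation V := 'rV['F_2]_n.

(** The conjugate of c Z^b X^a is monomial along t with phases c (-1)^(f(u).b). The second
    hypothesis makes t affine. The third says that the derivatives of f are affine, which is the
    phase condition of [monomial_clifford]. *)
Lemma perm_op_third_level_suff (f : V -> V) : injective f ->
    (forall a, exists t : V -> V,
       (forall u v, t (u + v) = t u + t v + t 0) /\ (forall u, f (t u) = f u + a)) ->
    (forall m, exists d, forall u v, f (m + (u + v)) + f (u + v) =
       (f (m + u) + f u) + (f (m + v) + f v) + d) ->
  clifford_hierarchy 3 (perm_op C f).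
Proof.
move=> fI fA fQ; split; first exact: perm_op_unitary.
move=> _ /pauli_groupP[c [a [b [c4 ->]]]].
have [t [tA tE]] := fA a; rewrite (conj_pauli_op _ _ fI tE).
apply: monomial_clifford => // [u v /(congr1 f)|u|m].
- by rewrite !tE => /addIr/fI.
- by rewrite rmorphM /= chi_conj mulrACA chi_sqr mulr1 phase_conj.
have [d dE] := fQ m.
have d0 : d = f m + f 0.
  have := dE 0 0; rewrite !addr0 => /eq_addv0 E.
  by apply: addv_eq0; rewrite -[RHS]E; addv_solve.
have [b' bE] : exists b', forall u, dot (f (m + u) + f u + d) b = dot u b'.
  apply: (additive_dot (h := fun u => dot (f (m + u) + f u + d) b)) => u v.
  rewrite -dotDl dE; congr (dot _ _).
  by move: (f (m + u)) (f u) (f (m + v)) (f v) => x y z w; addv_solve.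
exists (chi C (dot d b)), b'; split=> [|u]; first exact: chi_phase.
rewrite -bE mulrCA; congr (c * _); rewrite -!chiD -!dotDl; congr (chi _ (dot _ _)).
by move: (f (m + u)) (f u) => x y; addv_solve.
Qed.

(* If U = phi1 d phi2 with d diagonal, then the Paulis that phi2 conjugates to
   the Z^z are conjugated by U to Paulis. *)
Lemma semi_clifford_pauli_family (U : operator C n) : semi_clifford U ->
  exists p : V -> V * V, injective p /\ forall z, exists (c : C) a b,
    c ^+ 4 = 1 /\ U *m pauli_op (1 : C) (p z).1 (p z).2 = pauli_op c a b *m U.
Proof.
move=> [phi1 [d [phi2 [/clifford_gateP[_ P1] [_ dd] C2 ->]]]].
have /fin_all_exists[p pE] : forall z : V, exists p : V * V, exists c : C,
    c ^+ 4 = 1 /\ phi2 *m pauli_op (1 : C) p.1 p.2 = pauli_op c 0 z *m phi2.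
  move=> z; have [c [a [b [c4 E]]]] := clifford_preimage C2 0 z.
  by exists (a, b), c.
have phi2u : phi2 \in unitmx.
  by case/clifford_gateP: C2 => /unitarymx_unit.
exists p; split=> [z z' pz|z].
  have [c [c4]] := pE z; have [c' [c'4]] := pE z'; rewrite pz => ->.
  move/(can_inj (mulmxK phi2u)) => E.
  by case: (pauli_op_inj c'4 E).
have [c [c4 E]] := pE z; have [c' [a [b [c'4 E']]]] := P1 c 0 z c4.
exists c', a, b; split=> //.
have dZ : d *m pauli_op c 0 z = pauli_op c 0 z *m d.
  have [r ->] := diag_mxP _ dd; have /diag_mxP[s ->] : is_diag_mx (pauli_op c 0 z).
    apply/is_diag_mxP => i j ij; rewrite !mxE add0r (inj_eq enum_val_inj).
    by rewrite (negPf (ij : i != j)) mulr0.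
  exact: diag_mxC.
by rewrite -mulmxA E !mulmxA -(mulmxA phi1) dZ !mulmxA E'.
Qed.
End ThirdLevel.

Section SevenQubits.
Local Notation V := 'rV['F_2]_7.
Local Notation "x $ k" := (x (0 : 'I_1) (@Ordinal 7 k isT))
  (at level 2, k at level 1, format "x $ k").

(* The product of the augmentation ideal of F_2[a, b, c] / (a^2, b^2, c^2) in
   the basis a, b, c, ab, ac, bc, abc. *)
Definition cubic_prod (u w : V) : V := \row_(i < 7) match val i with
  | 3 => u$0 * w$1 + u$1 * w$0
  | 4 => u$0 * w$2 + u$2 * w$0
  | 5 => u$1 * w$2 + u$2 * w$1
  | 6 => u$0 * w$5 + u$5 * w$0 + (u$1 * w$4 + u$4 * w$1)
         + (u$2 * w$3 + u$3 * w$2)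
  | _ => 0
  end.

(** A quadratic map whose polar form is [cubic_prod]. *)
Definition cubic_quad (u : V) : V := \row_(i < 7) match val i with
  | 3 => u$0 * u$1
  | 4 => u$0 * u$2
  | 5 => u$1 * u$2
  | 6 => u$0 * u$5 + u$1 * u$4 + u$2 * u$3
  | _ => 0
  end.

Definition cubic_perm (u : V) : V := u + cubic_quad u.

Ltac by_coordinates := apply/rowP => -[[|[|[|[|[|[|[|//]]]]]]] ?];
  rewrite !mxE /= ?mxE /=; F2_ring.

Lemma cubic_prodDl u v w : cubic_prod (u + v) w = cubic_prod u w + cubic_prod v w.
Proof. by_coordinates. Qed.

Lemma cubic_prodDr u v w : cubic_prod w (u + v) = cubic_prod w u + cubic_prod w v.
Proof. by_coordinates. Qed.

Lemma cubic_permD u v : cubic_perm (u + v) =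
  cubic_perm u + cubic_perm v + cubic_prod u v.
Proof. by_coordinates. Qed.

(** By [cubic_permD] twice: [cubic_quad] vanishes on products, and u + v annihilates the product of
    u and v, so the two occurrences of that product cancel. *)
Lemma cubic_perm_circ u v : cubic_perm (u + v + cubic_prod u v) =
  cubic_perm u + cubic_perm v.
Proof. by_coordinates. Qed.

Lemma rV7_eq (u v : V) : u$0 = v$0 -> u$1 = v$1 -> u$2 = v$2 -> u$3 = v$3 ->
  u$4 = v$4 -> u$5 = v$5 -> u$6 = v$6 -> u = v.
Proof.
move=> *; apply/rowP => -[[|[|[|[|[|[|[|//]]]]]]] lt];
  by rewrite (bool_irrelevance lt isT).
Qed.

Lemma cubic_perm0 : cubic_perm 0 = 0.
Proof. by_coordinates. Qed.

(** The map is triangular in degree: coordinates 0 to 2 are fixed, they determine the correction to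
    3 to 5, and all six determine the correction to 6. *)
Lemma cubic_perm_inj : injective cubic_perm.
Proof.
move=> u v uv.
have E k : u 0 k + cubic_quad u 0 k = v 0 k + cubic_quad v 0 k.
  by have := congr1 (fun x : V => x 0 k) uv; rewrite /cubic_perm [LHS]mxE [RHS]mxE.
have E0 : u$0 = v$0 by have := E (@Ordinal 7 0 isT); rewrite !mxE /= !addr0.
have E1 : u$1 = v$1 by have := E (@Ordinal 7 1 isT); rewrite !mxE /= !addr0.
have E2 : u$2 = v$2 by have := E (@Ordinal 7 2 isT); rewrite !mxE /= !addr0.
have E3 : u$3 = v$3.
  by have := E (@Ordinal 7 3 isT); rewrite !mxE /= E0 E1 => /addIr.
have E4 : u$4 = v$4.
  by have := E (@Ordinal 7 4 isT); rewrite !mxE /= E0 E2 => /addIr.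
have E5 : u$5 = v$5.
  by have := E (@Ordinal 7 5 isT); rewrite !mxE /= E1 E2 => /addIr.
have E6 : u$6 = v$6.
  have := E (@Ordinal 7 6 isT); rewrite !mxE /= E0 E1 E2 E3 E4 E5.
  exact: addIr.
exact: rV7_eq.
Qed.

Lemma cubic_perm_third_level (C : numClosedFieldType) :
  clifford_hierarchy 3 (perm_op C cubic_perm).
Proof.
apply: perm_op_third_level_suff => [|a|m]; first exact: cubic_perm_inj.
  have /codomP[w ->] := injF_onto cubic_perm_inj a.
  exists (fun u => u + w + cubic_prod u w); split=> [u v|u].
    by rewrite !cubic_prodDl; by_coordinates.
  exact: cubic_perm_circ.
exists (cubic_perm m) => u v; rewrite !cubic_permD !cubic_prodDr; by_coordinates.
Qed.

Local Notation e k := (delta_mx 0 (@Ordinal 7 k isT) : V).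

Lemma cubic_prod_delta : [/\ cubic_prod (e 0) (e 1) = e 3,
  cubic_prod (e 0) (e 2) = e 4, cubic_prod (e 1) (e 2) = e 5 &
  cubic_prod (e 0) (e 5) = e 6].
Proof.
split; apply/rowP => -[[|[|[|[|[|[|[|//]]]]]]] lt]; rewrite !mxE /= ?mxE;
  exact: val_inj.
Qed.

(** The abc-coordinate of the product pairs each monomial of degree 1 or 2 with its complement, so
    products with basis vectors read off the first six coordinates of w. *)
Lemma cubic_prod_annihilator w : (forall u, cubic_prod w u = 0) ->
  [/\ w$0 = 0, w$1 = 0, w$2 = 0 & [/\ w$3 = 0, w$4 = 0 & w$5 = 0]].
Proof.
move=> w0.
have E k : cubic_prod w (delta_mx 0 k) 0 (@Ordinal 7 6 isT) = 0 by rewrite w0 mxE.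
have := (E (@Ordinal 7 0 isT), E (@Ordinal 7 1 isT), E (@Ordinal 7 2 isT),
         E (@Ordinal 7 3 isT), E (@Ordinal 7 4 isT), E (@Ordinal 7 5 isT)).
rewrite !mxE /= !(mulr0, mulr1, addr0, add0r).
by move=> [[[[[-> ->] ->] ->] ->] ->].
Qed.

Lemma cubic_perm_not_semi_clifford (C : numClosedFieldType) :
  ~ semi_clifford (perm_op C cubic_perm).
Proof.
move=> /semi_clifford_pauli_family[p [pI pE]].
(* If the gate takes Z^b X^a to c Z^b' X^a', then a + f u = f (a' + u) and f(u).b = u.b' for all u.
   The first forces a' to annihilate the product, with a = f a'; the second makes b orthogonal to
   all products, hence to e_3, ..., e_6. *)
have p0 z : [/\ (p z).1$0 = 0, (p z).1$1 = 0, (p z).1$2 = 0 &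
    [/\ (p z).1$3 = 0, (p z).1$4 = 0 & (p z).1$5 = 0]] /\
    [/\ (p z).2$3 = 0, (p z).2$4 = 0, (p z).2$5 = 0 & (p z).2$6 = 0].
  have [c [a' [b' [c4]]]] := pE z; move: (p z).1 (p z).2 => a b.
  rewrite !monomial_mul => /monomial_inj[u|/= G T].
    by rewrite !mul1r chi_neq0.
  have aE : a = cubic_perm a'.
    by have := T 0; rewrite /= cubic_perm0 !addr0.
  have a0 : forall u, cubic_prod a' u = 0.
    move=> u; have := T u; rewrite /= cubic_permD aE => /esym/eqP.
    by rewrite -subr_eq0 addrAC subrr add0r => /eqP.
  have [z0 z1 z2 [z3 z4 z5]] := cubic_prod_annihilator a0.
  split.
    by rewrite aE !mxE /= z0 z1 z2 z3 z4 z5 !(mulr0, addr0).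
  have c1 : c = 1 by have := G 0; rewrite cubic_perm0 !dot0l chi0 !mulr1.
  have fb u : dot (cubic_perm u) b = dot u b'.
    by apply: (@chi_inj C); have := G u; rewrite c1 !mul1r mulr1.
  have prod_b u v : dot (cubic_prod u v) b = 0.
    have := fb (u + v); rewrite cubic_permD (dotDl (_ + _)) (dotDl (cubic_perm u)) !fb.
    rewrite (dotDl u v) => /eqP.
    by rewrite -subr_eq0 addrAC subrr add0r => /eqP.
  have [e3 e4 e5 e6] := cubic_prod_delta.
  by rewrite -!dot_delta -e3 -e4 -e5 -e6 !prod_b.
(* Only four coordinates of (a, b) remain free, so 2^7 distinct pairs would inject into a set of
   size 2^4. *)
pose s z : 'F_2 * 'F_2 * 'F_2 * 'F_2 :=
  ((p z).1$6, (p z).2$0, (p z).2$1, (p z).2$2).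
have sI : injective s.
  move=> y z [s1 s2 s3 s4]; apply: pI.
  have [[ay0 ay1 ay2 [ay3 ay4 ay5]] [by3 by4 by5 by6]] := p0 y.
  have [[az0 az1 az2 [az3 az4 az5]] [bz3 bz4 bz5 bz6]] := p0 z.
  rewrite [p y]surjective_pairing [p z]surjective_pairing; congr (_, _).
    apply: rV7_eq s1; [exact: etrans ay0 (esym az0) | exact: etrans ay1 (esym az1)
    | exact: etrans ay2 (esym az2) | exact: etrans ay3 (esym az3)
    | exact: etrans ay4 (esym az4) | exact: etrans ay5 (esym az5)].
  apply: (rV7_eq s2 s3 s4); [exact: etrans by3 (esym bz3)
    | exact: etrans by4 (esym bz4) | exact: etrans by5 (esym bz5)
    | exact: etrans by6 (esym bz6)].
by have := leq_card s sI; rewrite !card_prod card_mx card_Fp.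
Qed.
End SevenQubits.

Theorem theoremA6 (R : realType) :
  (exists U : operator R[i] 7,
     [/\ permutation_gate U, clifford_hierarchy 3 U & ~ semi_clifford U]) /\
  (forall n : nat,
     (exists U : operator R[i] n,
        [/\ permutation_gate U, clifford_hierarchy 3 U & ~ semi_clifford U]) ->
     (7 <= n)%N).
Proof.
split.
  exists (perm_op _ cubic_perm); split.
  - by apply/permutation_gateP; exists cubic_perm; first exact: cubic_perm_inj.
  - exact: cubic_perm_third_level.
  - exact: cubic_perm_not_semi_clifford.
move=> n [U [Uperm U3 Unsc]]; rewrite leqNgt; apply/negP => n7.
exact/Unsc/third_level_semi_clifford.
Qed.
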